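(* Let $d\ge1$, $p\ge2$, $n<\infty$, and let $\{\xi(i,m):1\le i\le n,1\le m\le d\}$ be mutually independent centered random variables with $\mu_m(p)<\infty$ for all $m$. Then $$\sup_{b\in B(d,n)}|Q_d|_p\le 2^{d/2}\,\frac{p^d}{\log p}\prod_{m=1}^d\mu_m(p).$$
   Context: $I(d,n)=\{(i_1,\dots,i_d):1\le i_1<\dots<i_d\le n\}$, $\xi(I)=\prod_m\xi(i_m,m)$, $Q_d=\sum_{I\in I(d,n)}b(I)\xi(I)$, $B(d,n)=\{b:\sum_Ib(I)^2=1\}$. $|\eta|_p=(\mathbf E|\eta|^p)^{1/p}$, $\mu_m(p)=\sup_i|\xi(i,m)|_p$. *)

(* Defs.v *)
From HB Require Import structures.
From mathcomp Require Import all_boot all_order all_algebra.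
From mathcomp Require Import all_classical all_reals all_analysis.
From mathcomp Require Import probability.
Set Implicit Arguments. Unset Strict Implicit. Unset Printing Implicit Defensive.
Import Order.TTheory GRing.Theory Num.Theory.
Local Open Scope classical_set_scope.
Local Open Scope ring_scope.

Section Defs.
Context {d0 : measure_display} {T : measurableType d0} {R : realType}.

Definition mutually_independent (P : probability T R) (I : finType)
    (X : I -> T -> R) : Prop :=
  forall (J : {set I}) (B : I -> set R),
    (forall j, j \in J -> measurable (B j)) ->
    P (\bigcap_(j in [set j | j \in J]) (X j @^-1` B j)) =
    (\prod_(j in J) P (X j @^-1` B j))%E.

Definition incr_index (d n : nat) (I : {ffun 'I_d -> 'I_n}) : bool :=
  [forall j : 'I_d, forall k : 'I_d, (j < k)%N ==> (I j < I k)%N].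

Definition xiI (d n : nat) (xi : 'I_n -> 'I_d -> T -> R)
    (I : {ffun 'I_d -> 'I_n}) : T -> R :=
  fun w => \prod_(m < d) xi (I m) m w.

Definition Qd (d n : nat) (b : {ffun 'I_d -> 'I_n} -> R)
    (xi : 'I_n -> 'I_d -> T -> R) : T -> R :=
  fun w => \sum_(I | incr_index I) b I * xiI xi I w.

Definition Bdn (d n : nat) : set ({ffun 'I_d -> 'I_n} -> R) :=
  [set b | \sum_(I | incr_index I) b I ^+ 2 = 1].

Definition pnorm (P : probability T R) (p : R) (eta : T -> R) : \bar R :=
  Lnorm P p%:E (EFin \o eta).

Definition mu_m (P : probability T R) (d n : nat)
    (xi : 'I_n -> 'I_d -> T -> R) (p : R) (m : 'I_d) : \bar R :=
  \big[Order.max/0%E]_(i < n) pnorm P p (xi i m).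

End Defs.
Arguments Bdn {R} d n.

(* Main.v *)
Require Import Defs.
From HB Require Import structures.
From mathcomp Require Import all_boot all_order all_algebra.
From mathcomp Require Import all_classical all_reals all_analysis.
From mathcomp Require Import probability.
From mathcomp Require Import measurable_realfun ring lra.
Import Order.TTheory GRing.Theory Num.Theory.
Local Open Scope classical_set_scope.
Local Open Scope ring_scope.

(* Hypercontractivity for multilinear polynomials F = sum_A c(A) prod_(k in A) X_k
   in independent centered variables:
   |F|_p^2 <= sum_A c(A)^2 prod_(k in A) 3 p |X_k|_p^2.
   Singling out one variable, F = F_0 + X_k F_1 with F_0, F_1 independent of X_k.
   A pointwise inequality |x + y|^p <= (x^2 + 3 p y^2)^(p/2) + c(x) y, whose linear
   term integrates to 0, and Minkowski's inequality in L^(p/2) give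
   |F|_p^2 <= |F_0|_p^2 + 3 p |X_k|_p^2 |F_1|_p^2, and one inducts on the number of
   variables. Q_d is such a polynomial, indexed by the graphs {(i_m, m)} of the
   multi-indices, so |Q_d|_p <= (3 p)^(d/2) prod_m mu_m(p); finally
   3 (log p)^2 <= 2 p absorbs the constant. *)

(** * Elementary real inequalities *)

(** Young's inequality for the product of [1 + x] and [1], with exponent [q] and its conjugate. *)
Lemma bernoulli_powR (R : realType) (q x : R) :
  1 <= q -> 0 <= x -> 1 + q * x <= (1 + x) `^ q.
Proof.
rewrite le_eqVlt => /predU1P[<-|q1] x0; first by rewrite mul1r powRr1; lra.
have q0 : 0 < q by lra.
have qV1 : 0 < 1 - q^-1 by rewrite subr_gt0 invf_lt1.
have qV : q^-1 + (1 - q^-1)^-1^-1 = 1 by rewrite invrK addrC subrK.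
have := @conjugate_powR R (1 + x) 1 q (1 - q^-1)^-1 _ ler01 q0 _ qV.
rewrite mulr1 powR1 mul1r invrK invr_gt0 => /(_ _ qV1) H.
have {H} : 1 + x <= (1 + x) `^ q / q + (1 - q^-1) by apply: H; lra.
rewrite -lerBlDr ler_pdivlMr// => /(le_trans _); apply.
by rewrite mulrBl mulrBl mulVf ?gt_eqF//; lra.
Qed.

Lemma powR_le_expR (R : realType) (p t : R) :
  0 <= p -> -1 <= t -> (1 + t) `^ p <= expR (p * t).
Proof.
move=> p0 t1; rewrite mulrC expRM.
by rewrite ge0_ler_powR ?nnegrE ?expR_ge0 ?expR_ge1Dx//; lra.
Qed.

Lemma norm_powRE (R : realType) (p z : R) : `|z| `^ p = (z ^+ 2) `^ (p / 2).
Proof.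
rewrite -(real_normK (num_real z)) -powR_mulrn// -powRrM.
by congr powR; field.
Qed.

(** Cubing [1 - u / 3 <= expR (- (u / 3))] and inverting reduces the claim to a polynomial
    inequality. The coefficient [3 / 2] is the one Bernoulli gives: [p / 2 * (3 * p * t ^+ 2)] is
    [3 / 2 * (p * t) ^+ 2]. *)
Lemma expR_le_quadratic (R : realType) (u : R) :
  0 <= u <= 4 / 5 -> expR u <= 1 + u + 3 / 2 * u ^+ 2.
Proof.
move=> /andP[u0 u1].
have e3 : expR (- (u / 3)) >= 1 - u / 3 by exact: expR_ge1Dx.
have E : expR (- u) >= (1 - u / 3) ^+ 3.
  rewrite (_ : - u = - (u / 3) * 3%:R); last by field.
  by rewrite expRM_natr; apply: lerXn2r; rewrite ?nnegrE ?expR_ge0//; lra.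
have pos : 0 <= 1 + u + 3 / 2 * u ^+ 2 by nra.
have -> : expR u = 1 / expR (- u) by rewrite expRN div1r invrK.
rewrite ler_pdivrMr ?expR_gt0//.
apply: le_trans (ler_wpM2l pos E); rewrite mulrC.
have -> : (1 - u / 3) ^+ 3 * (1 + u + 3 / 2 * u ^+ 2) =
   1 + u ^+ 2 * (5 / 6 - 65 / 54 * u + 25 / 54 * u ^+ 2 - u ^+ 3 / 18) by field.
rewrite lerDl mulr_ge0 ?sqr_ge0//.
have u3 : u ^+ 3 <= 16 / 25 * u by rewrite exprS; nra.
nra.
Qed.

(** Since [expR v >= 1 + v], it suffices that [(1 - v + v ^+ 2) * (1 + v) = 1 + v ^+ 3] is at least
    1. *)
Lemma expRN_le_quadratic (R : realType) (v : R) :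
  0 <= v -> expR (- v) <= 1 - v + v ^+ 2.
Proof.
move=> v0; have ev := expR_ge1Dx v.
rewrite expRN -div1r ler_pdivrMr ?expR_gt0//.
have K0 : 0 <= 1 - v + v ^+ 2 by nra.
apply: le_trans (ler_wpM2l K0 ev).
have : 0 <= v ^+ 3 by rewrite exprn_ge0.
rewrite exprS; nra.
Qed.

(* With linear coefficient [p] on the right, the first-order terms at [t = 0]
   match; the constant [3] makes [(1 + t)^2 <= 1 + 3 p t^2] hold for
   [t >= 0] outside the range [p t <= 4 / 5]. *)
Lemma powR_two_point1 (R : realType) (p t : R) : 2 <= p ->
  `|1 + t| `^ p <= (1 + 3 * p * t ^+ 2) `^ (p / 2) + p * t.
Proof.
move=> p2.
have bern : 1 + 3 / 2 * (p * t) ^+ 2 <= (1 + 3 * p * t ^+ 2) `^ (p / 2).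
  rewrite (_ : 3 / 2 * _ = p / 2 * (3 * p * t ^+ 2)); last by field.
  by apply: bernoulli_powR; [lra | apply: mulr_ge0; [lra | exact: sqr_ge0]].
have [t0|t0] := leP 0 t.
  (* For [t > 0] this condition is exactly [(1 + t) ^+ 2 <= 1 + 3 * p * t ^+ 2]. When it fails,
     [p * t < 2 * p / (3 * p - 1) <= 4 / 5] because [p >= 2]. *)
  have [tp|tp] := leP 2 ((3 * p - 1) * t).
    rewrite norm_powRE.
    apply: (@le_trans _ _ ((1 + 3 * p * t ^+ 2) `^ (p / 2))); last nra.
    by apply: ge0_ler_powR; rewrite ?nnegrE; nra.
  have pt : 0 <= p * t <= 4 / 5 by apply/andP; split; nra.
  rewrite ger0_norm; last lra.
  have := @powR_le_expR _ p t; have := expR_le_quadratic _ _ pt.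
  by move=> + /(_ ltac:(lra) ltac:(lra)); lra.
have [t1|t1] := leP (-1) t.
  rewrite ger0_norm; last lra.
  have v0 : 0 <= - (p * t) by nra.
  have := @powR_le_expR _ p t _ t1; have := expRN_le_quadratic _ _ v0.
  rewrite opprK sqrrN => + /(_ ltac:(lra)); have := sqr_ge0 (p * t); lra.
(* For [t < -1] and [s = - t] it suffices that [s^p + p s] is at most the power on the right.
   Factoring out [s^p] and applying Bernoulli to [3 p = 1 + (3 p - 1)] gives this, as
   [p / 2 * (3 p - 1) >= p]. *)
have s1 : 1 < - t by lra.
set s := - t in s1.
have -> : t = - s by rewrite /s opprK.
rewrite sqrrN mulrN lerBrDr distrC ger0_norm; last lra.
have sp : 0 <= s `^ p by exact: powR_ge0.
have s_sp : s <= s `^ p by rewrite le1r_powR//; lra.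
have : (s - 1) `^ p <= s `^ p by apply: ge0_ler_powR; rewrite ?nnegrE; lra.
have : s `^ p * (1 + p / 2 * (3 * p - 1)) <= (1 + 3 * p * s ^+ 2) `^ (p / 2).
  have -> : s `^ p = (s ^+ 2) `^ (p / 2).
    by rewrite -norm_powRE ger0_norm//; lra.
  apply: (@le_trans _ _ ((s ^+ 2 * (1 + (3 * p - 1))) `^ (p / 2))).
    rewrite [leRHS]powRM ?sqr_ge0//; last lra.
    apply: ler_wpM2l; first exact: powR_ge0.
    by apply: bernoulli_powR; lra.
  by apply: ge0_ler_powR; rewrite ?nnegrE; nra.
have : p * s <= p * s `^ p by apply: ler_wpM2l; lra.
have : 0 <= s `^ p * (p * (3 * p - 3)) by do 2 apply: mulr_ge0 => //; lra.
lra.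
Qed.

(** Homogeneity reduces to [t = y / x]. The constant [c] is chosen before [y], so that [c * y]
    vanishes on averaging over a centered [y]. *)
Lemma powR_two_point (R : realType) (p x : R) : 2 <= p ->
  exists c, forall y,
    `|x + y| `^ p <= (x ^+ 2 + 3 * p * y ^+ 2) `^ (p / 2) + c * y.
Proof.
move=> p2.
have [->|x0] := eqVneq x 0.
  exists 0 => y; rewrite add0r mul0r addr0 norm_powRE expr0n add0r.
  have := sqr_ge0 y.
  by move=> y0; apply: ge0_ler_powR; rewrite ?nnegrE//; nra.
exists (p * `|x| `^ p / x) => y.
have -> : x + y = x * (1 + y / x) by rewrite mulrDr mulr1 mulrC divfK.
rewrite normrM powRM//.
apply: le_trans (ler_wpM2l (powR_ge0 _ _) (powR_two_point1 _ _ (y / x) p2)) _.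
rewrite mulrDr norm_powRE -powRM ?sqr_ge0//; last first.
  by have := sqr_ge0 (y / x); nra.
apply: lerD; last by rewrite le_eqVlt; apply/orP; left; apply/eqP; field.
by rewrite le_eqVlt; apply/orP; left; apply/eqP; congr (_ `^ _); field.
Qed.

(** With [s] the square root of [p], [ln p = 2 ln s <= 2 s / e <= 4 s / 5], and [3 * 16 / 25 <= 2].
    The bound [e >= 5 / 2] comes from [(1 + 1/6)^6]. *)
Lemma sqr_ln_le (R : realType) (p : R) : 1 <= p -> 3 * ln p ^+ 2 <= 2 * p.
Proof.
move=> p1.
have e : 5 / 2 <= expR 1 :> R.
  have -> : 1 = 6^-1 * 6%:R :> R by field.
  rewrite expRM_natr; apply: le_trans (_ : (1 + 6^-1) ^+ 6 <= _); first lra.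
  by apply: lerXn2r; rewrite ?nnegrE ?expR_ge0 ?expR_ge1Dx//; lra.
set s := Num.sqrt p.
have s0 : 0 < s by rewrite sqrtr_gt0; lra.
have sp : s ^+ 2 = p by rewrite sqr_sqrtr//; lra.
have lnp : ln p <= 4 / 5 * s.
  have := expR_ge1Dx (ln s - 1).
  rewrite addrC subrK expRD expRN lnK ?posrE// -sp lnXn//.
  have : s / expR 1 <= s * (2 / 5).
    by rewrite ler_pdivrMr ?expR_gt0//; nra.
  rewrite mulr2n; lra.
have : 0 <= ln p by exact: ln_ge0.
nra.
Qed.

(* The loss from the constant [3 p] per coordinate is absorbed because
   [3 / (2 p) <= 1], so that only one factor has to beat [ln p ^ 2]. *)
Lemma chaos_constant_le (R : realType) (d : nat) (p : R) : (1 <= d)%N -> 2 <= p ->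
  Num.sqrt ((3 * p) ^+ d) <= 2 `^ (d%:R / 2) * p ^+ d / ln p.
Proof.
case: d => // d _ p2.
have lnp : 0 < ln p by rewrite ln_gt0; lra.
rewrite ler_pdivlMr// powRrM powR_mulrn// powR12_sqrt; last exact: exprn_ge0.
rewrite -(@ler_pXn2r _ 2)// ?nnegrE; last 2 first.
- by rewrite mulr_ge0 ?sqrtr_ge0 ?ltW.
- by rewrite mulr_ge0 ?sqrtr_ge0 ?exprn_ge0//; lra.
rewrite exprMn [leRHS]exprMn !sqr_sqrtr ?exprn_ge0//; last lra.
rewrite -exprM mulnC exprM -exprMn (exprS (3 * p)) (exprS (2 * _)) [leLHS]mulrAC.
have H : 3 * ln p ^+ 2 <= 2 * p by apply: sqr_ln_le; lra.
apply: ler_pM.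
- by apply: mulr_ge0; [lra|exact: sqr_ge0].
- by rewrite exprn_ge0//; lra.
- by have := sqr_ge0 (ln p); nra.
- by apply: lerXn2r; rewrite ?nnegrE; nra.
Qed.

(** * Independence and iterated integrals *)

Section indep.
Local Open Scope ereal_scope.
Variables (R : realType) (d : measure_display) (T : measurableType d)
  (P : probability T R).

(** The finite measures [A |-> P (A & B)] and [P B * P] agree on the pi-system [G], hence on the
    sigma-algebra it generates. *)
Lemma indep_generated (G : set (set T)) (B : set T) :
  measurable B -> G `<=` measurable -> setI_closed G -> G setT ->
  (forall A, G A -> P (A `&` B) = P A * P B) ->
  forall A, <<s G >> A -> P (A `&` B) = P A * P B.
Proof.
move=> mB Gm GI GT GP A sA.
pose k : {nonneg R} := NngNum (fine_ge0 (measure_ge0 P B)).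
have kE : k%:num%:E = P B by rewrite fineK ?fin_num_measure.
pose m1 : {measure set T -> \bar R} := mrestr P mB.
pose m2 : {measure set T -> \bar R} := mscale k P.
have : m1 A = m2 A.
  apply: (g_sigma_algebra_measure_unique G Gm (fun=> setT)) => //.
  - by rewrite bigcup_const//; exists 0%N.
  - move=> C GC; rewrite /m1 /m2/= /mrestr /mscale/= kE GP// muleC//.
  - move=> _; rewrite /m1/= /mrestr setTI.
    by rewrite (le_lt_trans (probability_le1 _ _)) ?ltry.
by rewrite /m1 /m2/= /mrestr /mscale/= kE muleC.
Qed.

Lemma measurable_g_sigma_algebra d' (T' : measurableType d') (G : set (set T))
    (f : g_sigma_algebraType G -> T') :
  G `<=` measurable -> measurable_fun setT f -> measurable_fun setT (f : T -> T').
Proof.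
move=> Gm mf _ A mA; have := mf measurableT A mA.
by apply: smallest_sub => //; exact: sigma_algebra_measurable.
Qed.

(* [g_sigma_algebraType G] is [T] with the sigma-algebra generated by [G], so
   measurability of [f] says that its second argument only enters through
   [G]-events; the joint law of [X] and the identity is then a product measure. *)
Lemma indep_integral (X : {RV P >-> R}) (G : set (set T))
    (f : R * g_sigma_algebraType G -> \bar R) :
  G `<=` measurable -> setI_closed G -> G setT ->
  (forall A B, G A -> measurable B -> P (A `&` X @^-1` B) = P A * P (X @^-1` B)) ->
  measurable_fun setT f -> (forall z, 0 <= f z) ->
  \int[P]_w f (X w, w) = \int[P]_w \int[P]_v f (X v, w).
Proof.
move=> Gm GI GT GP mf f0.
have sGm : <<s G >> `<=` measurable.
  exact: smallest_sub (@sigma_algebra_measurable _ T) Gm.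
pose W : T -> g_sigma_algebraType G := id.
have mW : measurable_fun setT W.
  by move=> _ A mA; rewrite setTI; exact: sGm.
have mX : measurable_fun setT (X : T -> R) by [].
have mXW : measurable_fun setT (fun w => (X w, W w)) by exact: measurable_fun_pair.
pose W' : {mfun T >-> g_sigma_algebraType G} :=
  HB.pack W (isMeasurableFun.Build _ _ _ _ W mW).
pose XW' : {mfun T >-> (R * g_sigma_algebraType G)%type} :=
  HB.pack (fun w => (X w, W w)) (isMeasurableFun.Build _ _ _ _ _ mXW).
transitivity (\int[distribution P XW']_z f z).
  by rewrite ge0_integral_distribution.
(* The joint law factors on rectangles by [indep_generated], which characterizes the product
   measure. *)
transitivity (\int[distribution P X \x distribution P W']_z f z).
  apply: eq_measure_integral => A mA _; apply/esym/product_measure_unique => //.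
  move=> B C mB mC.
  rewrite /distribution /pushforward/= /W.
  rewrite [RHS]muleC -(@indep_generated G (X @^-1` B))//.
  - by congr (P _); apply/seteqP; split => x /= [].
  - by rewrite -(setTI (_ @^-1` _)); exact: mX.
  - by move=> A' GA'; exact: GP.
rewrite fubini_tonelli2// ge0_integral_distribution//=; last 2 first.
- exact: measurable_fun_fubini_tonelli_G.
- by move=> y; rewrite /fubini_G; exact: integral_ge0.
apply: eq_integral => w _; rewrite /fubini_G.
rewrite ge0_integral_distribution//.
exact: measurableT_comp.
Qed.

(** Comparison conditionally on [G]: the inequality is needed only after averaging over [X] with the
    second argument frozen. *)
Lemma indep_integral_le (X : {RV P >-> R}) (G : set (set T))
    (f g : R * g_sigma_algebraType G -> \bar R) :
  G `<=` measurable -> setI_closed G -> G setT ->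
  (forall A B, G A -> measurable B -> P (A `&` X @^-1` B) = P A * P (X @^-1` B)) ->
  measurable_fun setT f -> measurable_fun setT g ->
  (forall z, 0 <= f z) -> (forall z, 0 <= g z) ->
  (forall w, \int[P]_v f (X v, w) <= \int[P]_v g (X v, w)) ->
  \int[P]_w f (X w, w) <= \int[P]_w g (X w, w).
Proof.
move=> Gm GI GT GP mf mg f0 g0 fg.
have mint (h : R * g_sigma_algebraType G -> \bar R) :
    measurable_fun setT h -> (forall z, 0 <= h z) ->
    measurable_fun setT (fun w : T => \int[P]_v h (X v, w)).
  move=> mh h0; have := @measurable_fun_fubini_tonelli_G _ _ R _ _
    (distribution P X) h mh h0.
  move=> /(measurable_g_sigma_algebra _ _ _ _ Gm).
  apply: eq_measurable_fun => w _; rewrite /fubini_G.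
  by rewrite ge0_integral_distribution//; exact: measurableT_comp.
rewrite !indep_integral//; apply: ge0_le_integral => //.
- by move=> w _; exact: integral_ge0.
- exact: mint.
- exact: mint.
Qed.

End indep.

(** * Adding one independent variable in L^p *)

Section chaos_step.
Local Open Scope ereal_scope.
Variables (R : realType) (d : measure_display) (T : measurableType d)
  (P : probability T R).

Lemma measurable_EFin_powR d' (T' : measurableType d') (f : T' -> R) (r : R) :
  measurable_fun setT f -> measurable_fun setT (fun w => (f w `^ r)%:E).
Proof.
by move=> mf; apply/measurable_EFinP; exact: measurableT_comp (measurable_powR r) mf.
Qed.

Lemma ge0_le_integralT (f g : T -> \bar R) :
  measurable_fun setT f -> measurable_fun setT g ->
  (forall w, 0 <= f w) -> (forall w, f w <= g w) ->
  \int[P]_w f w <= \int[P]_w g w.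
Proof. by move=> mf mg f0 fg; apply: ge0_le_integral => // w _; exact: f0. Qed.

Lemma powR_two_point_integral (X : T -> R) (p a q : R) : (2 <= p)%R ->
  P.-integrable setT (EFin \o X) -> \int[P]_w (X w)%:E = 0 ->
  \int[P]_w (`|a + X w * q| `^ p)%:E <=
  \int[P]_w ((a ^+ 2 + 3 * p * (X w * q) ^+ 2) `^ (p / 2))%:E.
Proof.
move=> p2 iX EX0; have [c Hc] := powR_two_point _ _ a p2.
have mX : measurable_fun setT X by apply/measurable_EFinP; exact: measurable_int iX.
have mXq : measurable_fun setT (fun w => X w * q)%R by exact: measurable_funM.
set g := fun w => ((a ^+ 2 + 3 * p * (X w * q) ^+ 2) `^ (p / 2))%:E.
have mg : measurable_fun setT g.
  apply/measurable_EFin_powR/measurable_funD => //.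
  by apply: measurable_funM => //; exact: measurable_funX.
have g0 w : 0 <= g w by rewrite lee_fin powR_ge0.
(* Once the right side is finite, [g] is integrable and the centered linear term can be split
   off. *)
have [goo|gfin] := eqVneq (\int[P]_w g w) +oo; first by rewrite goo leey.
have ig : P.-integrable setT g.
  apply/integrableP; split => //.
  under eq_integral do rewrite gee0_abs//.
  by rewrite ltey.
have icX : P.-integrable setT (fun w => (c * q)%:E * (X w)%:E).
  exact: integrableZl.
apply: (@le_trans _ _ (\int[P]_w (g w + (c * q)%:E * (X w)%:E))); last first.
  by rewrite integralD// integralZl// EX0 mule0 adde0.
apply: ge0_le_integralT => //.
- apply/measurable_EFin_powR/measurableT_comp => //.
  exact: measurable_funD.
- by apply: measurable_int; exact: integrableD ig icX.
- by move=> w; rewrite /g -EFinM -EFinD lee_fin; have := Hc (X w * q)%R; lra.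
Qed.

Lemma Lnorm_scale (f : T -> R) (p c : R) :
  measurable_fun setT f -> (0 < p)%R -> (0 <= c)%R ->
  'N[P]_p%:E[EFin \o (fun w => c * f w)%R] = c%:E * 'N[P]_p%:E[EFin \o f].
Proof.
move=> mf p0 c0; rewrite unlock /=.
under eq_integral do rewrite normrM (ger0_norm c0) powRM// EFinM.
rewrite ge0_integralZl_EFin ?powR_ge0//; last first.
  exact/measurable_EFin_powR/measurableT_comp.
rewrite poweRM ?lee_fin ?powR_ge0//; last first.
  by apply: integral_ge0 => w _; rewrite lee_fin powR_ge0.
by rewrite poweR_EFin -powRrM mulfV ?gt_eqF// powRr1.
Qed.

Lemma Lnorm_sqr (f : T -> R) (p : R) :
  (0 < p)%R ->
  'N[P]_(p / 2)%R%:E[EFin \o (fun w => f w ^+ 2)%R] = 'N[P]_p%:E[EFin \o f] `^ 2.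
Proof.
move=> p0; rewrite unlock /=.
have -> : ((p / 2)^-1 = p^-1 * 2)%R by rewrite invfM invrK.
rewrite poweRrM; congr (_ `^ _ `^ _); apply: eq_integral => w _.
by rewrite ger0_norm ?sqr_ge0// norm_powRE.
Qed.

Variables (X : {RV P >-> R}) (G : set (set T)).
Hypotheses (Gm : G `<=` measurable) (GI : setI_closed G) (GT : G setT).
Hypothesis XG : forall A B, G A -> measurable B ->
  P (A `&` X @^-1` B) = P A * P (X @^-1` B).

Lemma indep_Lnorm (p : R) (F : g_sigma_algebraType G -> R) :
  measurable_fun setT F -> (0 < p)%R ->
  'N[P]_p%:E[EFin \o (fun w => X w * F w)%R] =
  'N[P]_p%:E[EFin \o (X : T -> R)] * 'N[P]_p%:E[EFin \o F].
Proof.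
move=> mF p0; have mF' := measurable_g_sigma_algebra _ _ _ _ _ _ Gm mF.
rewrite unlock /= -poweRM; last 2 first.
- by apply: integral_ge0 => w _; rewrite lee_fin powR_ge0.
- by apply: integral_ge0 => w _; rewrite lee_fin powR_ge0.
congr (_ `^ _).
have -> : \int[P]_w (`|X w * F w| `^ p)%:E =
    \int[P]_w \int[P]_v (`|X v * F w| `^ p)%:E.
  apply: (@indep_integral R d T P X G (fun z => (`|z.1 * F z.2| `^ p)%:E)) => //.
  - apply/measurable_EFin_powR/measurableT_comp => //.
    by apply: measurable_funM => //; exact: measurableT_comp mF _.
transitivity (\int[P]_w ((\int[P]_v (`|X v| `^ p)%:E) * (`|F w| `^ p)%:E)).
  apply: eq_integral => w _.
  under eq_integral do rewrite normrM powRM// EFinM muleC.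
  rewrite ge0_integralZl_EFin ?powR_ge0//; first exact: muleC.
  exact/measurable_EFin_powR/measurableT_comp.
rewrite ge0_integralZl//.
- exact/measurable_EFin_powR/measurableT_comp.
- by apply: integral_ge0 => w _; rewrite lee_fin powR_ge0.
Qed.

(** The induction step. Bounds are kept as square roots because it is the squared norms that add
    up. *)
Lemma indep_Lnorm_affine_le (p : R) (F0 F1 : g_sigma_algebraType G -> R)
    (a b m : R) :
  (2 <= p)%R -> 'E_P[X] = 0 ->
  measurable_fun setT F0 -> measurable_fun setT F1 ->
  (0 <= a)%R -> (0 <= b)%R -> (0 <= m)%R ->
  'N[P]_p%:E[EFin \o (X : T -> R)] <= m%:E ->
  'N[P]_p%:E[EFin \o F0] <= (Num.sqrt a)%:E ->
  'N[P]_p%:E[EFin \o F1] <= (Num.sqrt b)%:E ->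
  'N[P]_p%:E[EFin \o (fun w => F0 w + X w * F1 w)%R] <=
  (Num.sqrt (a + 3 * p * m ^+ 2 * b))%:E.
Proof.
move=> p2 EX mF0 mF1 a0 b0 m0 Xm F0a F1b.
have p0 : (0 < p)%R by lra.
have cb : (0 <= 3 * p * m ^+ 2 * b)%R.
  by apply: mulr_ge0 => //; apply: mulr_ge0; [lra|exact: sqr_ge0].
have mF0' := measurable_g_sigma_algebra _ _ _ _ _ _ Gm mF0.
have mF1' := measurable_g_sigma_algebra _ _ _ _ _ _ Gm mF1.
have mX : measurable_fun setT (X : T -> R) by [].
have mXF1 : measurable_fun setT (fun w => X w * F1 w)%R by exact: measurable_funM.
have iX : P.-integrable setT (EFin \o (X : T -> R)).
  apply/Lfun1_integrable.
  (* On a probability space L^p is contained in L^1, which makes the expectation a genuine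
     integral. *)
  have : (X : T -> R) \in Lfun P p%:E.
    rewrite inE; apply/andP; split; rewrite inE//=.
    by rewrite /finite_norm (le_lt_trans Xm) ?ltry.
  have p1 : 1 <= p%:E by rewrite lee_fin; lra.
  apply: (@Lfun_subset _ _ _ P 1 p%:E (lexx 1) p1 _ p1).
  exact: fin_num_measure.
have EX0 : \int[P]_w (X w)%:E = 0 by rewrite -EX unlock.
have XF1 : 'N[P]_p%:E[EFin \o (fun w => Num.sqrt (3 * p) * (X w * F1 w))%R] <=
    (Num.sqrt (3 * p * m ^+ 2 * b))%:E.
  rewrite Lnorm_scale// ?sqrtr_ge0// indep_Lnorm//.
  have -> : (Num.sqrt (3 * p * m ^+ 2 * b) = Num.sqrt (3 * p) * (m * Num.sqrt b))%R.
    have c0 : (0 <= 3 * p)%R by lra.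
    rewrite sqrtrM; last by rewrite mulr_ge0 ?sqr_ge0.
    by rewrite sqrtrM// sqrtr_sqr (ger0_norm m0) mulrA.
  rewrite 2!EFinM.
  apply: lee_wpmul2l; first by rewrite lee_fin sqrtr_ge0.
  by apply: lee_pmul => //; exact: Lnorm_ge0.
(* Absorbing [3 * p] into [h] makes [g] a sum of two squares, ready for Minkowski in L^(p/2) and
   [Lnorm_sqr]. *)
set h := fun w => (Num.sqrt (3 * p) * (X w * F1 w))%R in XF1.
have mh : measurable_fun setT h by exact: measurable_funM.
have poweR2_le (x : \bar R) (y : R) : 0 <= x -> (0 <= y)%R ->
    x <= (Num.sqrt y)%:E -> x `^ 2 <= y%:E.
  move=> x0 y0 xy; rewrite -(sqr_sqrtr y0) -powR_mulrn ?sqrtr_ge0// -poweR_EFin.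
  by apply: gt0_ler_poweR; rewrite // in_itv/= ?leey ?andbT// lee_fin sqrtr_ge0.
set g := fun w => (F0 w ^+ 2 + h w ^+ 2)%R.
have Ng : 'N[P]_(p / 2)%R%:E[EFin \o g] <= (a + 3 * p * m ^+ 2 * b)%:E.
  apply: (le_trans (@minkowski_EFin _ _ _ P (fun w => F0 w ^+ 2)%R
    (fun w => h w ^+ 2)%R _ _ _ _)).
  - exact: measurable_funX.
  - exact: measurable_funX.
  - lra.
  rewrite !Lnorm_sqr// EFinD.
  by apply: leeD; apply: poweR2_le => //; exact: Lnorm_ge0.
have gE w : g w = (F0 w ^+ 2 + 3 * p * (X w * F1 w) ^+ 2)%R.
  by rewrite /g /h exprMn sqr_sqrtr//; lra.
have g0 w : (0 <= g w)%R by rewrite addr_ge0 ?sqr_ge0.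
have key : \int[P]_w (`|F0 w + X w * F1 w| `^ p)%:E <=
    \int[P]_w (`|g w| `^ (p / 2))%:E.
  under [leRHS]eq_integral do rewrite ger0_norm// gE.
  apply: (@indep_integral_le R d T P X G
    (fun z => (`|F0 z.2 + z.1 * F1 z.2| `^ p)%:E)
    (fun z => ((F0 z.2 ^+ 2 + 3 * p * (z.1 * F1 z.2) ^+ 2) `^ (p / 2))%:E)) => //=.
  - apply/measurable_EFin_powR/measurableT_comp => //.
    apply: measurable_funD; first exact: measurableT_comp mF0 _.
    by apply: measurable_funM => //; exact: measurableT_comp mF1 _.
  - apply/measurable_EFin_powR/measurable_funD.
      by apply: measurable_funX; exact: measurableT_comp mF0 _.
    apply: measurable_funM => //; apply: measurable_funX.
    by apply: measurable_funM => //; exact: measurableT_comp mF1 _.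
  - by move=> z; rewrite lee_fin powR_ge0.
  - move=> w; exact: (powR_two_point_integral _ _ (F0 w) (F1 w) p2 iX EX0).
rewrite unlock /= in Ng *.
have c0 : (0 <= a + 3 * p * m ^+ 2 * b)%R by exact: addr_ge0.
set c := (a + _)%R in Ng c0 *.
have -> : (Num.sqrt c = c `^ 2^-1)%R by rewrite powR12_sqrt.
rewrite -poweR_EFin.
(* The L^p norm is thus bounded by the square root of the L^(p/2) norm of [g]. *)
have -> : (p^-1 = (p / 2)^-1 * 2^-1)%R by field; lra.
rewrite poweRrM; apply: gt0_ler_poweR.
- lra.
- by rewrite in_itv/= poweR_ge0 leey.
- by rewrite in_itv/= lee_fin c0 leey.
apply: le_trans Ng; apply: gt0_ler_poweR => //.
- by rewrite invr_ge0; lra.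
- by rewrite in_itv/= leey andbT integral_ge0// => w _; rewrite lee_fin powR_ge0.
- by rewrite in_itv/= leey andbT integral_ge0// => w _; rewrite lee_fin powR_ge0.
Qed.
End chaos_step.

(** * Cylinder events of a subfamily *)

Section cylinders.
Variables (R : realType) (d : measure_display) (T : measurableType d)
  (P : probability T R) (K : finType) (X : K -> {RV P >-> R}).

(** A pi-system generating the sigma-algebra of the [X j], [j \in S]. Bases are given for every
    index of [K], so that intersections are taken basewise. *)
Definition cylinders (S : {set K}) : set (set T) :=
  [set A | exists2 B : K -> set R, (forall j, measurable (B j)) &
    A = \bigcap_(j in [set j | j \in S]) X j @^-1` B j].

Lemma cylinders_measurable S : cylinders S `<=` measurable.
Proof.
move=> _ [B mB ->]; apply: fin_bigcap_measurable => // j _.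
by rewrite -[_ @^-1` _]setTI; exact: (measurable_funP (X j)).
Qed.

Lemma cylinders_setI S : setI_closed (cylinders S).
Proof.
move=> _ _ [B mB ->] [C mC ->]; exists (fun j => B j `&` C j).
  by move=> j; exact: measurableI.
by rewrite -bigcapI.
Qed.

Lemma cylinders_setT S : cylinders S setT.
Proof.
by exists (fun=> setT) => //; apply/seteqP; split.
Qed.

Lemma measurable_cylinders (S : {set K}) (j : K) : j \in S ->
  measurable_fun setT (X j : g_sigma_algebraType (cylinders S) -> R).
Proof.
move=> jS _ C mC; rewrite setTI; apply: sub_sigma_algebra.
exists (fun i => if i == j then C else setT); first by move=> i; case: ifP.
apply/seteqP; split => w /=.
  by move=> XC i _ /=; case: eqP => [->|].
by move=> /(_ j jS) /=; rewrite eqxx.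
Qed.

Lemma cylinders_indep (S : {set K}) (k : K) (A : set T) (C : set R) :
  mutually_independent P (fun j => X j : T -> R) -> k \notin S ->
  cylinders S A -> measurable C ->
  P (A `&` X k @^-1` C) = (P A * P (X k @^-1` C))%E.
Proof.
move=> Xind kS [B mB ->] mC.
(* The intersection is a cylinder over [k |: S] with bases [D]; independence is used for [S] and for
   [k |: S]. *)
pose D j := if j == k then C else B j.
have mD j : measurable (D j) by rewrite /D; case: ifP.
have DB j : j \in S -> D j = B j.
  by rewrite /D; case: eqP => // ->; rewrite (negbTE kS).
rewrite (Xind S B)//.
have -> : \bigcap_(j in [set j | j \in S]) X j @^-1` B j `&` X k @^-1` C =
    \bigcap_(j in [set j | j \in k |: S]) X j @^-1` D j.
  apply/seteqP; split => w /=.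
    move=> [wB wC] j /=; rewrite finset.in_setU1 => /predU1P[->|jS].
      by rewrite /D eqxx.
    by rewrite DB//; exact: wB.
  move=> wD; split.
    by move=> j /= jS; rewrite -DB//; apply: wD; rewrite /= finset.in_setU1 jS orbT.
  by have := wD k; rewrite /= finset.setU11 /D eqxx; exact.
rewrite (Xind (k |: S) D)// big_setU1//= muleC; congr (_ * _)%E.
  by apply: eq_bigr => j jS; rewrite DB.
by rewrite /D eqxx.
Qed.

End cylinders.

(** * Multilinear polynomials in independent variables *)

(** Subsets of [k |: S] either avoid [k] or arise from a unique subset of [S] by adding [k]. This
    yields the splitting [F_0 + X_k F_1]. *)
Lemma sum_subsetU1 (V : nmodType) (K : finType) (S : {set K}) (k : K)
    (f : {set K} -> V) : k \notin S ->
  \sum_(A : {set K} | A \subset k |: S) f A =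
  \sum_(A : {set K} | A \subset S) f A +
  \sum_(A : {set K} | A \subset S) f (k |: A).
Proof.
move=> kS; rewrite (bigID (fun A : {set K} => k \notin A))/=; congr (_ + _).
  apply: eq_bigl => A; apply/andP/idP => [[AS kA]|AS].
    by rewrite -(finset.setU1K kS) subsetD1 AS.
  split; first by rewrite (fintype.subset_trans AS) ?finset.subsetUr.
  by apply: contra kS; exact: (fintype.subsetP AS).
rewrite (reindex_onto (fun A : {set K} => k |: A) (fun A => A :\ k)) /=; last first.
  by move=> A /andP[_ /negPn kA]; exact: finset.setD1K.
apply: eq_bigl => A; rewrite finset.setU11 andbT.
apply/andP/idP => [[AS /eqP AE]|AS].
  by rewrite -AE -(finset.setU1K kS); exact: finset.setSD.
have kA : k \notin A by apply: contra kS; exact: (fintype.subsetP AS).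
by rewrite finset.setUS// finset.setU1K.
Qed.

Lemma multilinear_Lnorm_le (R : realType) (d : measure_display)
    (T : measurableType d) (P : probability T R) (K : finType)
    (X : K -> {RV P >-> R}) (p : R) (m : K -> R) :
  2 <= p -> mutually_independent P (fun k => X k : T -> R) ->
  (forall k, 'E_P[X k] = 0)%E -> (forall k, 0 <= m k) ->
  (forall k, 'N[P]_p%:E[EFin \o (X k : T -> R)] <= (m k)%:E)%E ->
  forall (S : {set K}) (c : {set K} -> R),
  ('N[P]_p%:E[EFin \o (fun w => \sum_(A : {set K} | A \subset S)
      c A * \prod_(k in A) X k w)%R] <=
  (Num.sqrt (\sum_(A : {set K} | A \subset S)
      c A ^+ 2 * \prod_(k in A) (3 * p * m k ^+ 2)))%:E)%E.
Proof.
move=> p2 Xind EX m0 Xm S.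
(* The induction keeps [c] general, since [F_1] has the shifted coefficients [c (k |: A)]. *)
elim: {S}_.+1 {-2}S (ltnSn #|S|) => // s IHs S Ss c.
have [->|/finset.set0Pn[k kS]] := eqVneq S finset.set0.
  have sum0 (f : {set K} -> R) :
      \sum_(A : {set K} | A \subset finset.set0) f A = f finset.set0.
    by apply: big_pred1 => A; rewrite finset.subset0.
  rewrite unlock; under eq_integral do rewrite /= sum0 finset.big_set0 mulr1.
  rewrite sum0 finset.big_set0 mulr1.
  have PT : P setT = 1%E by exact: probability_setT.
  rewrite integral_cst// [X in (_ * X)%E]PT mule1 poweR_EFin -powRrM mulfV.
    by rewrite powRr1// sqrtr_sqr.
  by rewrite gt_eqF//; lra.
rewrite -(finset.setD1K kS); set S' := S :\ k.
have kS' : k \notin S' by rewrite in_setD1 eqxx.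
have S's : (#|S'| < s)%N.
  by move: Ss; rewrite (cardsD1 k S) kS.
rewrite (sum_subsetU1 _ _ _ _ _ kS').
have kA (A : {set K}) : A \subset S' -> k \notin A.
  by move=> AS; apply: contra kS'; exact: (fintype.subsetP AS).
pose F (c : {set K} -> R) := fun w : T =>
  \sum_(A : {set K} | A \subset S') c A * \prod_(i in A) X i w.
pose ck A := c (k |: A).
(* Measurability for the cylinders over [S'], which omits [k], is what makes both parts independent
   of [X k]. *)
have mF c' : measurable_fun setT
    (F c' : g_sigma_algebraType (cylinders R d T P K X S') -> R).
  rewrite (_ : F c' = fun w => \sum_(A : {set K})
      if A \subset S' then c' A * \prod_(i in A) X i w else 0); last first.
    by apply/funext => w; apply: big_mkcond.
  apply: measurable_sum => A; case: (boolP (A \subset S')) => // AS.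
  apply: measurable_funM => //.
  rewrite (_ : (fun w => _) =
      fun w => \prod_(i : K) if i \in A then X i w else 1); last first.
    by apply/funext => w; apply: big_mkcond.
  apply: measurable_prod => i _; case: (boolP (i \in A)) => // iA.
  by apply: measurable_cylinders; exact: (fintype.subsetP AS).
have sge0 (c' : {set K} -> R) : 0 <= \sum_(A : {set K} | A \subset S')
    c' A ^+ 2 * \prod_(i in A) (3 * p * m i ^+ 2).
  apply: sumr_ge0 => A _; apply: mulr_ge0; first exact: sqr_ge0.
  by apply: prodr_ge0 => i _; apply: mulr_ge0; [lra|exact: sqr_ge0].
rewrite (_ : (fun w => _) = (fun w => F c w + X k w * F ck w)); last first.
  apply/funext => w; rewrite (sum_subsetU1 _ _ _ _ _ kS'); congr (_ + _).
  rewrite /F mulr_sumr; apply: eq_bigr => A AS.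
  by rewrite big_setU1 ?kA// mulrCA.
rewrite (_ : \sum_(A | _) _ ^+ 2 * \prod_(i in k |: A) _ =
    3 * p * m k ^+ 2 * \sum_(A : {set K} | A \subset S')
    ck A ^+ 2 * \prod_(i in A) (3 * p * m i ^+ 2)); last first.
  rewrite mulr_sumr; apply: eq_bigr => A AS.
  by rewrite big_setU1 ?kA//= mulrCA.
apply: (@indep_Lnorm_affine_le _ _ _ P (X k) (cylinders _ _ _ _ _ X S')) => //.
- exact: cylinders_measurable.
- exact: cylinders_setI.
- exact: cylinders_setT.
- by move=> A B GA mB; exact: cylinders_indep GA mB.
- exact: IHs.
- exact: IHs.
Qed.

(** * Multi-indices as sets of variables, and the moment bound *)

Definition ffun_graph (d n : nat) (I : {ffun 'I_d -> 'I_n}) :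
  {set 'I_n * 'I_d} := [set (I m, m) | m in 'I_d]%SET.

Lemma ffun_graph_inj (d n : nat) : injective (ffun_graph d n).
Proof.
move=> I J IJ; apply/ffunP => m.
have : (I m, m) \in ffun_graph d n J by rewrite -IJ; apply: imset_f.
by case/imsetP => m' _ [-> <-].
Qed.

Lemma big_ffun_graph (R : Type) (idx : R) (op : Monoid.com_law idx)
    (d n : nat) (I : {ffun 'I_d -> 'I_n}) (f : 'I_n * 'I_d -> R) :
  \big[op/idx]_(k in ffun_graph d n I) f k = \big[op/idx]_(m < d) f (I m, m).
Proof. by rewrite big_imset//= => m m' _ _ []. Qed.

(** Transfers sums over sets of variables to sums over multi-indices; a set that is no graph has an
    empty fiber and coefficient 0. *)
Lemma sum_fiber (R : comPzRingType) (I J : finType) (Q : pred I) (g : I -> J)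
    (b : I -> R) (h : J -> R) :
  \sum_j (\sum_(i | Q i && (g i == j)) b i) * h j = \sum_(i | Q i) b i * h (g i).
Proof.
rewrite [RHS](partition_big g xpredT)//=; apply: eq_bigr => j _.
by rewrite mulr_suml; apply: eq_bigr => i /andP[_ /eqP ->].
Qed.

Theorem theorem7 (R : realType) (d0 : measure_display) (T : measurableType d0)
    (P : probability T R) (d n : nat) (p : R)
    (xi : 'I_n -> 'I_d -> {RV P >-> R}) :
  (1 <= d)%N -> 2 <= p ->
  mutually_independent P (fun im : 'I_n * 'I_d => (xi im.1 im.2 : T -> R)) ->
  (forall i m, ('E_P[xi i m] = 0)%E) ->
  (forall m, (mu_m P (fun i m => xi i m : T -> R) p m < +oo)%E) ->
  (ereal_sup [set pnorm P p (Qd b (fun i m => xi i m : T -> R)) | b in Bdn d n]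
   <= (2 `^ (d%:R / 2) * p ^+ d / ln p)%:E
      * \prod_(m < d) mu_m P (fun i m => xi i m : T -> R) p m)%E.
Proof.
move=> d1 p2 xi_ind xi0 mu_fin.
set mu := mu_m P _ p in mu_fin *.
have mu_ge i m : (pnorm P p (xi i m : T -> R) <= mu m)%E by exact: le_bigmax.
have mu_ge0 m : (0 <= mu m)%E.
  (* The maximum starts from 0, which also covers [n = 0]. *)
  by rewrite /mu /mu_m; elim/big_rec: _ => // i x _ x0; rewrite le_max x0 orbT.
pose M m := fine (mu m).
have muE m : mu m = (M m)%:E by rewrite fineK// ge0_fin_numE.
have M0 m : 0 <= M m by exact: fine_ge0.
under eq_bigr do rewrite muE.
rewrite (_ : \prod_(m < d) (M m)%:E = (\prod_(m < d) M m)%:E)%E; last first.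
  by apply/esym/big_morph => // x y; rewrite EFinM.
have prodM0 : 0 <= \prod_(m < d) M m by apply: prodr_ge0.
apply: ge_ereal_sup => _ [b bB <-].
pose X (k : 'I_n * 'I_d) := xi k.1 k.2.
pose c A := \sum_(I | incr_index I && (ffun_graph d n I == A)) b I.
have cE I : incr_index I -> c (ffun_graph d n I) = b I.
  move=> incrI; apply: big_pred1 => J; rewrite (inj_eq (@ffun_graph_inj d n)).
  by rewrite /= andb_idl// => /eqP ->.
rewrite /pnorm.
rewrite (_ : Qd b _ = fun w => \sum_(A : {set 'I_n * 'I_d} | A \subset [set: _]%SET)
    c A * \prod_(k in A) X k w); last first.
  apply/funext => w; under [RHS]eq_bigl do rewrite finset.subsetT.
  rewrite sum_fiber; apply: eq_bigr => I _.
  by rewrite big_ffun_graph.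
apply: le_trans (@multilinear_Lnorm_le R d0 T P _ X p (fun k => M k.2)
  p2 xi_ind _ _ _ [set: _]%SET c) _ => //.
- by move=> k; exact: xi0.
- by move=> k; rewrite -muE; exact: mu_ge.
rewrite -EFinM lee_fin.
under eq_bigl do rewrite finset.subsetT.
(* Every graph meets each column [m] exactly once, so all products agree and factor out of the sum
   of the [b I ^+ 2], which is 1. *)
rewrite (_ : \sum_(A : {set _}) _ = (3 * p) ^+ d * (\prod_(m < d) M m) ^+ 2).
  rewrite sqrtrM; last by rewrite exprn_ge0//; lra.
  rewrite sqrtr_sqr ger0_norm// ler_wpM2r//.
  exact: chaos_constant_le.
(* One factor [c A] is expanded as a fiber sum; the other becomes [b I] by injectivity of the
   graph. *)
under eq_bigr do rewrite expr2 -mulrA.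
rewrite sum_fiber.
rewrite (eq_bigr (fun I => b I ^+ 2 * ((3 * p) ^+ d * (\prod_(m < d) M m) ^+ 2))).
  by rewrite -mulr_suml bB mul1r.
move=> I incrI; rewrite cE// [LHS]mulrA -expr2; congr (_ * _).
rewrite big_ffun_graph/= big_split/= prodr_const card_ord; congr (_ * _).
by rewrite prodrXl.
Qed.
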